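(* Let $\alpha,a\in\mathbb{R}$. For every integer $N\ge 0$ and all $x\in\mathbb{R}$, $$Q^{(\alpha,-a)}_N(x)=\sum_{\nu=0}^N\binom{N}{\nu}Q^{(0,-a)}_{\nu}(x)\,Q^{(\alpha,1)}_{N-\nu}(x).$$
   Context: Throughout $x$ is a real variable, $\alpha,a$ are real parameters, $\sigma(x)=1+x^2$, and $\cot^{-1}:\mathbb{R}\to(0,\pi)$ is the smooth branch, so that $\frac{d}{dx}\cot^{-1}x=-1/\sigma(x)$. For integers $l\ge 0$ put $w_l(x)=\sigma(x)^{-(l+a+1)}e^{-\alpha\cot^{-1}x}=\sigma(x)^{-l}w_0(x)$. Define $P_l^{(a,\alpha)}(x)=\frac{1}{w_l(x)}\frac{d^l}{dx^l}[w_l(x)\sigma(x)^l]=\frac{\sigma(x)^l}{w_0(x)}\frac{d^l w_0(x)}{dx^l}$. The complementary (Romanovski) polynomials $Q_\nu^{(\alpha,-a)}$, with $Q_0^{(\alpha,-a)}\equiv 1$, are defined by the Rodrigues representation $P_l^{(a,\alpha)}(x)=\frac{1}{w_l(x)}\frac{d^{l-\nu}}{dx^{l-\nu}}[\sigma(x)^{l-\nu}w_l(x)Q_\nu^{(\alpha,-a)}(x)]$ for all integers $0\le\nu\le l$ (the case $l=\nu$ reads $Q_\nu^{(\alpha,-a)}=P_\nu^{(a,\alpha)}$). The second upper index is minus the parameter $a$ of the weight; thus $Q^{(0,-a)}_\nu$ has $\alpha$ replaced by $0$, and $Q^{(\alpha,1)}_{\nu}$ has $a$ replaced by $-1$. 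*)

(* Defs.v *)
From Stdlib Require Import Reals Lra Lia.
From Coquelicot Require Import Coquelicot.
Open Scope R_scope.

Definition sigma (x : R) : R := 1 + x ^ 2.

(* The branch with values in (0, PI), smooth on all of R. *)
Definition acot (x : R) : R := PI / 2 - atan x.

Definition w (a alpha : R) (l : nat) (x : R) : R :=
  Rpower (sigma x) (- (INR l + a + 1)) * exp (- alpha * acot x).

Definition P (a alpha : R) (l : nat) (x : R) : R :=
  1 / w a alpha l x * Derive_n (fun y => w a alpha l y * sigma y ^ l) l x.

(* [Q alpha b nu x] stands for Q_nu^{(alpha, b)}(x): the second upper index is
   [b = - a], where [a] is the parameter of the weight. The Rodrigues
   representation with [l = nu] determines [Q] uniquely; existence is
   [is_complementary_family_exists] below. *)
Definition is_complementary_family (Q : R -> R -> nat -> R -> R) : Prop :=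
  forall alpha a : R,
    (forall x : R, Q alpha (- a) 0%nat x = 1) /\
    (forall (l nu : nat), (nu <= l)%nat -> forall x : R,
      P a alpha l x =
      1 / w a alpha l x *
      Derive_n (fun y => sigma y ^ (l - nu) * w a alpha l y * Q alpha (- a) nu y)
               (l - nu) x).

Lemma sigma_gt0 (x : R) : 0 < sigma x.
Proof. unfold sigma; nra. Qed.

Lemma w_gt0 (a alpha : R) (l : nat) (x : R) : 0 < w a alpha l x.
Proof. apply Rmult_lt_0_compat; apply exp_pos. Qed.

Lemma w_sigma (a alpha : R) (l : nat) (x : R) :
  w a alpha l x * sigma x ^ l = w a alpha 0 x.
Proof.
unfold w.
rewrite <- (Rpower_pow l (sigma x) (sigma_gt0 x)).
replace (Rpower (sigma x) (- (INR 0 + a + 1)))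
  with (Rpower (sigma x) (- (INR l + a + 1)) * Rpower (sigma x) (INR l)).
- ring.
- rewrite <- Rpower_plus; f_equal; simpl; ring.
Qed.

Lemma P_w0 (a alpha : R) (l : nat) (x : R) :
  P a alpha l x = sigma x ^ l / w a alpha 0 x * Derive_n (w a alpha 0) l x.
Proof.
unfold P.
rewrite (Derive_n_ext _ (w a alpha 0)) by (intros; apply w_sigma).
rewrite <- (w_sigma a alpha l x).
field; split.
- apply Rgt_not_eq, pow_lt, sigma_gt0.
- apply Rgt_not_eq, w_gt0.
Qed.

Lemma is_complementary_family_exists :
  is_complementary_family (fun alpha b nu x => P (- b) alpha nu x).
Proof.
intros alpha a; rewrite Ropp_involutive; split.
- intros x; unfold P; simpl; field; apply Rgt_not_eq, w_gt0.
- intros l nu Hle x; unfold P at 1; f_equal.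
  rewrite (Derive_n_ext _ (w a alpha 0)) by (intros; apply w_sigma).
  replace l with ((l - nu) + nu)%nat at 1 by lia.
  rewrite <- Derive_n_comp.
  apply Derive_n_ext; intros t.
  rewrite P_w0, <- (w_sigma a alpha l t).
  replace (sigma t ^ l) with (sigma t ^ (l - nu) * sigma t ^ nu)
    by (rewrite <- pow_add; f_equal; lia).
  field; repeat split; apply Rgt_not_eq;
    first [apply w_gt0 | apply pow_lt, sigma_gt0].
Qed.

(* Main.v *)
Require Import Defs.
From Stdlib Require Import Reals Lra Lia.
From Coquelicot Require Import Coquelicot.
Open Scope R_scope.

(** The Rodrigues representation with [l = nu] makes the complementary
    polynomial a normalised derivative of the weight,
    [Q_nu^{(alpha,-a)} = sigma^nu / w_0 * w_0^{(nu)}], where [w_0] is the weight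
    with parameters [(a, alpha)].  That weight is the product
    [sigma^{-(a+1)} * exp (- alpha * acot x)], and each factor is again a weight
    of the same kind: the first has parameters [(a, 0)] and the second
    [(-1, alpha)], since [a = -1] kills the power of [sigma] ([w0_factor]).
    Applying Leibniz's rule ([Derive_n_mult]) to the product and distributing
    [sigma^N = sigma^nu * sigma^{N-nu}] over the terms gives the identity.

    Leibniz's rule requires the weights to be smooth.  This comes from
    [w_{a,alpha}' = (alpha - 2 (a+1) x) * w_{a+1,alpha}] ([is_derive_w0]): the
    derivative of a weight is an affine function times another weight, so by
    induction on [n], for all [a] at once, every weight has [n] derivatives. *)

(** Pascal's rule summed against an arbitrary array: this is the combinatorial
    content of the induction step of any binomial formula. *)
Lemma sum_pascal (u : nat -> nat -> R) (n : nat) :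
  sum_f_R0 (fun k => Binomial.C n k * u (S k) (n - k)%nat) n
  + sum_f_R0 (fun k => Binomial.C n k * u k (S n - k)%nat) n
  = sum_f_R0 (fun k => Binomial.C (S n) k * u k (S n - k)%nat) (S n).
Proof.
rewrite (decomp_sum _ (S n)) by lia; simpl Init.Nat.pred.
destruct n as [|m].
- cbn [sum_f_R0 Nat.sub]; rewrite !C_n_n, !C_n_0; ring.
- rewrite (decomp_sum (fun k => Binomial.C (S m) k * u k (S (S m) - k)%nat) (S m))
    by lia.
  simpl Init.Nat.pred; rewrite !tech5, !C_n_0, !C_n_n.
  rewrite (sum_eq (fun i => Binomial.C (S (S m)) (S i) * _)
    (fun i => Binomial.C (S m) i * u (S i) (S m - i)%nat
              + Binomial.C (S m) (S i) * u (S i) (S (S m) - S i)%nat)).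
  + rewrite sum_plus.
    replace (S (S m) - S (S m))%nat with (S m - S m)%nat by lia; ring.
  + intros i Hi; rewrite <- pascal by lia.
    replace (S (S m) - S i)%nat with (S m - i)%nat by lia; ring.
Qed.

Lemma ex_derive_n_Derive (f : R -> R) (n : nat) (x : R) :
  ex_derive_n f (S (S n)) x -> ex_derive_n (Derive f) (S n) x.
Proof.
simpl; apply ex_derive_ext; intros t.
change (Derive f) with (Derive_n f 1).
rewrite Derive_n_comp, Nat.add_comm; reflexivity.
Qed.

Lemma ex_derive_n_of_Derive (f : R -> R) (n : nat) (x : R) :
  ex_derive_n (Derive f) (S n) x -> ex_derive_n f (S (S n)) x.
Proof.
simpl; apply ex_derive_ext; intros t.
change (Derive f) with (Derive_n f 1).
rewrite Derive_n_comp, Nat.add_comm; reflexivity.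
Qed.

(** Derivatives up to order [n], everywhere.  Quantifying over the orders below
    [n] makes the notion monotone in [n] by construction. *)
Definition times_derivable (n : nat) (f : R -> R) : Prop :=
  forall (k : nat) (x : R), (k <= n)%nat -> ex_derive_n f k x.

Lemma times_derivable_le (m n : nat) (f : R -> R) :
  (m <= n)%nat -> times_derivable n f -> times_derivable m f.
Proof. intros Hmn Hf k x Hk; apply Hf; lia. Qed.

Lemma times_derivable_ext (n : nat) (f g : R -> R) :
  (forall x, f x = g x) -> times_derivable n f -> times_derivable n g.
Proof. intros Hfg Hf k x Hk; apply ex_derive_n_ext with f; auto. Qed.

Lemma times_derivable_plus (n : nat) (f g : R -> R) :
  times_derivable n f -> times_derivable n g ->
  times_derivable n (fun x => f x + g x).
Proof.
intros Hf Hg k x Hk.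
apply ex_derive_n_plus; apply filter_forall; intros y j Hj;
  [apply Hf | apply Hg]; lia.
Qed.

Lemma times_derivable_S (n : nat) (f : R -> R) :
  times_derivable (S n) f <->
  (forall x, ex_derive f x) /\ times_derivable n (Derive f).
Proof.
split.
- intros Hf; split.
  + intros x; apply (Hf 1%nat); lia.
  + intros [|k] x Hk; [exact I|].
    apply ex_derive_n_Derive, Hf; lia.
- intros [H1 Hf] [|[|k]] x Hk; [exact I | apply H1 |].
  apply ex_derive_n_of_Derive, Hf; lia.
Qed.

Lemma times_derivable_mult (n : nat) (f g : R -> R) :
  times_derivable n f -> times_derivable n g ->
  times_derivable n (fun x => f x * g x).
Proof.
revert f g; induction n as [|n IH]; intros f g Hf Hg.
- intros k x Hk; replace k with 0%nat by lia; exact I.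
- destruct (proj1 (times_derivable_S _ _) Hf) as [Hf1 Hf'].
  destruct (proj1 (times_derivable_S _ _) Hg) as [Hg1 Hg'].
  apply times_derivable_S; split.
  + intros x; apply @ex_derive_mult; auto.
  + apply times_derivable_ext with (fun x => Derive f x * g x + f x * Derive g x).
    { intros x; symmetry; apply Derive_mult; auto. }
    apply times_derivable_plus; apply IH; auto;
      apply times_derivable_le with (S n); auto.
Qed.

(** Leibniz's rule.  The induction differentiates once first, so that the
    hypothesis applies to the two products [f' * g] and [f * g']. *)
Lemma Derive_n_mult (n : nat) (f g : R -> R) (x : R) :
  times_derivable n f -> times_derivable n g ->
  Derive_n (fun y => f y * g y) n x =
  sum_f_R0 (fun k => Binomial.C n k * (Derive_n f k x * Derive_n g (n - k) x)) n.
Proof.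
revert f g; induction n as [|n IH]; intros f g Hf Hg.
- simpl; rewrite C_n_0; ring.
- destruct (proj1 (times_derivable_S _ _) Hf) as [Hf1 Hf'].
  destruct (proj1 (times_derivable_S _ _) Hg) as [Hg1 Hg'].
  assert (Hf0 : times_derivable n f) by (apply times_derivable_le with (S n); auto).
  assert (Hg0 : times_derivable n g) by (apply times_derivable_le with (S n); auto).
  assert (Hcomp : forall h k, Derive_n (Derive h) k x = Derive_n h (S k) x).
  { intros h k; change (Derive h) with (Derive_n h 1).
    rewrite Derive_n_comp, Nat.add_comm; reflexivity. }
  rewrite <- Hcomp.
  rewrite (Derive_n_ext _ (fun y => Derive f y * g y + f y * Derive g y))
    by (intros y; apply Derive_mult; auto).
  rewrite Derive_n_plus by (apply filter_forall; intros y k Hk;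
    apply (times_derivable_mult n); auto).
  rewrite !IH by assumption.
  rewrite <- (sum_pascal (fun i j => Derive_n f i x * Derive_n g j x) n).
  f_equal; apply sum_eq; intros k Hk; rewrite Hcomp; [reflexivity|].
  replace (S (n - k)) with (S n - k)%nat by lia; reflexivity.
Qed.

(** The power of [sigma] drops by one under differentiation, and so does the
    power in [w (a + 1)]; the derivative of [acot] contributes another
    [1 / sigma], which is why both terms share that weight. *)
Lemma is_derive_w0 (a alpha x : R) :
  is_derive (w a alpha 0) x ((alpha - 2 * (a + 1) * x) * w (a + 1) alpha 0 x).
Proof.
assert (Hs := sigma_gt0 x).
replace (w (a + 1) alpha 0 x) with (w a alpha 0 x / Defs.sigma x).
- unfold w, Rpower, acot, Defs.sigma in *; auto_derive; [lra|].
  simpl; unfold Rsqr, Rminus; field; nra.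
- rewrite <- (w_sigma a alpha 1 x).
  unfold w; simpl INR.
  replace (- (0 + (a + 1) + 1)) with (- (1 + a + 1)) by ring.
  field; lra.
Qed.

Lemma times_derivable_affine (n : nat) (b c : R) :
  times_derivable n (fun x => b - c * x).
Proof.
revert b c; induction n as [|n IH]; intros b c.
- intros k x Hk; replace k with 0%nat by lia; exact I.
- apply times_derivable_S; split.
  + intros x; auto_derive; trivial.
  + apply times_derivable_ext with (fun x => - c - 0 * x); [|apply IH].
    intros x; symmetry; apply is_derive_unique; auto_derive; [trivial | ring].
Qed.

Lemma times_derivable_w0 (n : nat) (a alpha : R) :
  times_derivable n (w a alpha 0).
Proof.
revert a; induction n as [|n IH]; intros a.
- intros k x Hk; replace k with 0%nat by lia; exact I.
- apply times_derivable_S; split.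
  + intros x; eexists; apply is_derive_w0.
  + apply times_derivable_ext
      with (fun x => (alpha - 2 * (a + 1) * x) * w (a + 1) alpha 0 x).
    { intros x; symmetry; apply is_derive_unique, is_derive_w0. }
    apply times_derivable_mult; [apply times_derivable_affine | apply IH].
Qed.

Lemma w0_factor (a alpha x : R) :
  w a alpha 0 x = w a 0 0 x * w (- 1) alpha 0 x.
Proof.
unfold w; simpl INR.
replace (- (0 + -1 + 1)) with 0 by ring.
replace (- 0 * acot x) with 0 by ring.
rewrite Rpower_O by apply sigma_gt0.
rewrite exp_0; ring.
Qed.

Lemma complementary_family_w0 (Q : R -> R -> nat -> R -> R)
  (hQ : is_complementary_family Q) (alpha a : R) (n : nat) (x : R) :
  Q alpha (- a) n x = Defs.sigma x ^ n / w a alpha 0 x * Derive_n (w a alpha 0) n x.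
Proof.
rewrite <- P_w0, (proj2 (hQ alpha a) n n (le_n n) x), Nat.sub_diag; simpl.
field; apply Rgt_not_eq, w_gt0.
Qed.

Theorem theorem2p3 (Q : R -> R -> nat -> R -> R) (hQ : is_complementary_family Q)
  (alpha a : R) (N : nat) (x : R) :
  Q alpha (- a) N x =
  sum_f_R0 (fun nu => Binomial.C N nu * Q 0 (- a) nu x * Q alpha 1 (N - nu)%nat x) N.
Proof.
rewrite (complementary_family_w0 Q hQ).
rewrite (Derive_n_ext _ _ _ _ (w0_factor a alpha)).
rewrite Derive_n_mult by apply times_derivable_w0.
rewrite scal_sum; apply sum_eq; intros nu Hnu.
replace 1 with (- (- 1)) by ring.
rewrite !(complementary_family_w0 Q hQ), w0_factor.
replace (Defs.sigma x ^ N) with (Defs.sigma x ^ nu * Defs.sigma x ^ (N - nu))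
  by (rewrite <- pow_add; f_equal; lia).
field; split; apply Rgt_not_eq, w_gt0.
Qed.
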